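(* Let $G$ be any graph. Then there exists a mitigating set $S\subseteq E(G)$ for $G$ of size $|S|=\mathrm{es}_{\chi'}(G)$ such that every edge $e=uv\in S$ satisfies $$\max\{d_G(u),d_G(v)\}\geq \Delta(G)-1.$$
   Context: All graphs are finite, simple (no loops or multiple edges) and have at least one edge. $d_G(v)$ denotes the degree of $v$ in $G$ and $\Delta(G)$ the maximum degree of $G$. The chromatic index $\chi'(G)$ is the minimum number of colors in a proper edge coloring of $G$ (incident edges receive different colors); an edgeless graph, which may arise after deleting edges, has chromatic index $0$. A mitigating set of $G$ is a set of edges $F\subseteq E(G)$ such that $\chi'(G\setminus F)<\chi'(G)$, where $G\setminus F$ is obtained by deleting the edges of $F$ and keeping all vertices. The chromatic edge stability index $\mathrm{es}_{\chi'}(G)$ is the minimum number of edges of $G$ whose removal results in a graph $H$ with $\chi'(H)=\chi'(G)-1$; equivalently, the minimum size of a mitigating set of $G$. *)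

(* Defs.v *)
From mathcomp Require Import all_boot.

Set Implicit Arguments.
Unset Strict Implicit.
Unset Printing Implicit Defensive.

(* A simple graph on the vertex set T is given by its edge set E, a set of    *)
(* two-element subsets of T; the edge uv is [set u; v].  Deleting F yields    *)
(* E :\: F on the same T.                                                     *)
Definition simple_graph (T : finType) (E : {set {set T}}) : bool :=
  [forall e in E, #|e| == 2].

Definition degree (T : finType) (E : {set {set T}}) (v : T) : nat :=
  #|[set e in E | v \in e]|.

Definition max_degree (T : finType) (E : {set {set T}}) : nat :=
  \max_(v : T) degree E v.

(* Colorings are functions on the subtype of edges, so that an edgeless graph *)
(* has a coloring with 0 colors.                                              *)
Definition proper_edge_coloring (T : finType) (E : {set {set T}}) (k : nat)
    (c : {ffun {e : {set T} | e \in E} -> 'I_k}) : bool :=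
  [forall a : {e : {set T} | e \in E}, forall b : {e : {set T} | e \in E},
     (a != b) && ~~ [disjoint val a & val b] ==> (c a != c b)].

Definition edge_colorable (T : finType) (E : {set {set T}}) (k : nat) : bool :=
  [exists c : {ffun {e : {set T} | e \in E} -> 'I_k}, proper_edge_coloring c].

Lemma edge_colorable_exists (T : finType) (E : {set {set T}}) :
  exists k, edge_colorable E k.
Proof.
exists #|{: {e : {set T} | e \in E}}|; apply/existsP.
exists [ffun a => enum_rank a]; apply/forallP => a; apply/forallP => b.
apply/implyP => /andP[neq_ab _].
by rewrite !ffunE (inj_eq enum_rank_inj).
Qed.

Definition chromatic_index (T : finType) (E : {set {set T}}) : nat :=
  ex_minn (edge_colorable_exists E).

Definition mitigating (T : finType) (E F : {set {set T}}) : bool :=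
  (F \subset E) && (chromatic_index (E :\: F) < chromatic_index E).

(* The default value #|E| of the minimum does not matter when E is nonempty:  *)
(* deleting one class of an optimal coloring lowers the chromatic index by    *)
(* exactly one, so some F satisfies the condition, and then #|F| <= #|E|.     *)
Definition chromatic_edge_stability (T : finType) (E : {set {set T}}) : nat :=
  \big[minn/#|E|]_(F : {set {set T}} |
      (F \subset E) && ((chromatic_index (E :\: F)).+1 == chromatic_index E))
    #|F|.

(* Main.v *)
Require Import Defs.
From mathcomp Require Import all_boot.
From mathcomp Require Import perm.

Set Implicit Arguments.
Unset Strict Implicit.
Unset Printing Implicit Defensive.

(** Write k = chi'(E) - 1 and Delta for the maximum degree; k >= Delta - 1,
    because the edges at a vertex of maximum degree need distinct colors.
    A mitigating set F of minimum size is the set of edges left uncolored by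
    some partial proper coloring of E with k colors.  Suppose that an edge uv
    of F has both degrees below Delta - 1.  Then u and v have degree less than
    k, so each of them misses a color, and Vizing's fan argument can be run
    at u from the uncolored edge uv.  It has two possible outcomes
    ([fan_dichotomy]):
    - uv gets colored, possibly after a Kempe swap, and F minus uv is a smaller
      mitigating set, which is impossible;
    - the fan meets a vertex w that misses no color; rotating the colors along
      the fan colors uv and uncolors uw instead.  As w sees all the k
      colors, its degree is at least k >= Delta - 1 ([saturated_degree]).
    In the second case uw replaces uv in F: the size is the same, and there is
    one edge fewer with both ends of degree below Delta - 1
    ([mitigating_exchange]).  Hence a minimum mitigating set with the fewest
    such edges has none. *)

(** * Orbits of two involutions *)

(** The combinatorial core of a Kempe chain argument.  A chain in colors alpha
    and beta is an orbit of the two involutions that follow the edges of one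
    color; a vertex that misses the color is a fixed point.  The chain from u
    is a path, and if it leads to a or b, the first of them that it meets is
    its other end.  So the chain from u does not contain both.  The points of
    the chain are X i = (f g)^i u and g (X i); the walk is stopped when it
    meets a or b, or when X is about to return to u. *)
Lemma two_involutions_separate (T : finType) (f g : T -> T) (u a b : T) :
    involutive f -> involutive g -> f u = u -> g a = a -> g b = b ->
    a != b ->
  exists S : {set T},
    [/\ u \in S, {in S, forall x, f x \in S}, {in S, forall x, g x \in S}
      & ~~ ((a \in S) && (b \in S))].
Proof.
move=> fK gK fu ga gb neq_ab.
pose p x := f (g x); pose X i := iter i p u.
have XS i : X i.+1 = f (g (X i)) by [].
pose stop n := (X n \in [:: a; b]) || (X n.+1 == u).
have ex_stop: exists n, stop n.
  exists (order p u).-1.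
  rewrite /stop /X prednK ?order_gt0 // iter_order ?eqxx ?orbT //.
  by apply: inj_comp; apply: inv_inj.
case: (ex_minnP ex_stop) => n stop_n min_n.
pose S := [set y | [exists i : 'I_n.+1, (y == X i) || (g y == X i)]].
have inS y i : i <= n -> (y == X i) || (g y == X i) -> y \in S.
  move=> le_in yXi; rewrite inE; apply/existsP.
  by exists (Ordinal (le_in : i < n.+1)).
have fX i : i <= n -> f (X i) \in S.
  case: i => [|i] le_in; first by apply: (inS _ 0) => //; rewrite fu eqxx.
  by apply: (inS _ i); [apply: ltnW | rewrite XS fK gK eqxx orbT].
(* At an end of the chain g fixes X n, and the walk turns back. *)
have Xn1 : X n.+1 \in S.
  case/orP: stop_n => [Xn |/eqP->]; last by apply: (inS _ 0); rewrite ?eqxx.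
  have gXn : g (X n) = X n by move: Xn; rewrite !inE => /orP[] /eqP->.
  by rewrite XS gXn; apply: fX.
exists S; split.
- by apply: (inS _ 0); rewrite ?eqxx.
- move=> y; rewrite inE => /existsP[i /orP[/eqP-> | /eqP gy]].
    by apply: fX; apply: leq_ord.
  have -> : f y = X i.+1 by rewrite XS -gy gK.
  have := ltn_ord i; rewrite ltnS leq_eqVlt => /orP[/eqP-> // | lt_in].
  by apply: (inS _ i.+1); rewrite ?eqxx.
- move=> y; rewrite inE => /existsP[i yXi].
  by apply: (inS _ i); rewrite 1?leq_ord // gK orbC.
have last_hit y : y \in [:: a; b] -> y \in S -> y = X n.
  move=> yab; have gy : g y = y by move: yab; rewrite !inE => /orP[] /eqP->.
  rewrite inE gy => /existsP[i]; rewrite orbb => /eqP yXi.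
  have le_ni : n <= i by apply: min_n; rewrite /stop -yXi yab.
  by rewrite yXi; congr X; apply/eqP; rewrite eqn_leq le_ni -ltnS ltn_ord.
apply/andP => [[aS bS]]; case/eqP: neq_ab.
have aX : a = X n by apply: last_hit aS; apply: mem_head.
have bX : b = X n by apply: last_hit bS; rewrite !inE eqxx orbT.
exact: etrans aX (esym bX).
Qed.

(** * Partial edge colorings *)

Lemma set2_injr (T : finType) (x y z : T) :
  [set x; y] = [set x; z] -> y = z.
Proof.
move=> eq_xyz; have: y \in [set x; z] by rewrite -eq_xyz set22.
have: z \in [set x; y] by rewrite eq_xyz set22.
rewrite !inE => /orP[/eqP-> | /eqP-> //] /orP[] /eqP-> //.
Qed.

Section PartialColoring.

Variables T C : finType.
Implicit Types (c : {set T} -> option C) (u v w x y z : T) (K : {set T}).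

(** A coloring acts on sets rather than on ordered pairs of vertices, so that it
    is symmetric by construction; [None] marks the uncolored sets. *)
Definition proper c :=
  forall x y z a, c [set x; y] = Some a -> c [set x; z] = Some a -> y = z.

Definition colored c : {set {set T}} := [set e | c e].

Definition missing c x a := [forall y, c [set x; y] != Some a].

Lemma missingP c x a :
  reflect (forall y, c [set x; y] <> Some a) (missing c x a).
Proof. by apply: (iffP forallP) => H y; apply/eqP/H. Qed.

Lemma notmissingP c x a :
  reflect (exists y, c [set x; y] = Some a) (~~ missing c x a).
Proof.
apply: (iffP forallPn) => [[y /negPn/eqP] | [y cxy]]; first by exists y.
by exists y; rewrite cxy eqxx.
Qed.

Definition recolor c e o : {set T} -> option C :=
  fun f => if f == e then o else c f.

Lemma uncolor_proper c e : proper c -> proper (recolor c e None).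
Proof.
by move=> cP x y z a; rewrite /recolor; do 2!case: eqP => // _; apply: cP.
Qed.

Lemma recolor_proper c x y a :
    proper c -> missing c x a -> missing c y a ->
  proper (recolor c [set x; y] (Some a)).
Proof.
move=> cP /missingP xa /missingP ya.
have absurd z t s : [set z; t] = [set x; y] -> c [set z; s] <> Some a.
  move=> eq_zt; have: z \in [set x; y] by rewrite -eq_zt set21.
  by rewrite !inE => /orP[] /eqP->.
move=> z t s b; rewrite /recolor.
case: eqP => [eq_zt | _]; case: eqP => [eq_zs | _].
- by move=> _ _; apply: (@set2_injr _ z); rewrite eq_zt.
- by case=> <- /(absurd _ _ _ eq_zt).
- by move=> + [eq_ab]; rewrite -eq_ab => /(absurd _ _ _ eq_zs).
- exact: cP.
Qed.

Lemma colored_recolor c e a : colored (recolor c e (Some a)) = e |: colored c.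
Proof. by apply/setP=> f; rewrite !inE /recolor; case: eqP. Qed.

Lemma colored_uncolor c e : colored (recolor c e None) = colored c :\ e.
Proof. by apply/setP=> f; rewrite !inE /recolor; case: eqP. Qed.

Lemma proper_omap (D : Type) c (h : C -> D) :
    injective h -> proper c ->
  forall x y z a, omap h (c [set x; y]) = Some a ->
    omap h (c [set x; z]) = Some a -> y = z.
Proof.
move=> h_inj cP x y z a.
case cxy: (c _) => [b|] //= [<-]; case cxz: (c _) => [d|] //= [/h_inj eq_db].
by apply: cP cxy _; rewrite cxz eq_db.
Qed.

(** * Kempe chains *)

Definition partner c a x := odflt x [pick y | c [set x; y] == Some a].

Lemma partnerE c a x y : proper c -> c [set x; y] = Some a -> partner c a x = y.
Proof.
move=> cP cxy; rewrite /partner.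
case: pickP => [z /eqP cxz | /(_ y)]; first exact: cP cxz cxy.
by rewrite cxy eqxx.
Qed.

Lemma partner_missing c a x : missing c x a -> partner c a x = x.
Proof.
by move/missingP=> xa; rewrite /partner; case: pickP => // y /eqP/xa.
Qed.

Lemma partnerK c a : proper c -> involutive (partner c a).
Proof.
move=> cP x; have [xa | /notmissingP[y cxy]] := boolP (missing c x a).
  by rewrite !partner_missing.
by rewrite (partnerE cP cxy) (partnerE (y := x)) // setUC.
Qed.

(** K is a union of components of the graph of the edges colored a or b. *)
Definition kempe_closed c a b K :=
  forall x y d, c [set x; y] = Some d -> d \in [:: a; b] ->
    (x \in K) = (y \in K).

(** The three vertices are ends of (a, b)-chains.  A chain has at most two ends,
    so the chain of u avoids x or y, and its complement can be swapped without
    changing the colors at u. *)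
Lemma kempe_separate c a b u x y :
    proper c -> missing c u a -> missing c x b -> missing c y b -> x != y ->
  exists K, [/\ kempe_closed c a b K, u \notin K & (x \in K) || (y \in K)].
Proof.
move=> cP ua xb yb neq_xy.
have [||||| S [uS Sa Sb nS]] := @two_involutions_separate T
  (partner c a) (partner c b) u x y _ _ _ _ _ neq_xy.
- exact: partnerK.
- exact: partnerK.
- exact: partner_missing.
- exact: partner_missing.
- exact: partner_missing.
exists (~: S); split; rewrite ?inE ?uS //; last by rewrite -negb_and.
have sub s t d: c [set s; t] = Some d -> d \in [:: a; b] -> s \in S -> t \in S.
  move=> cst dab sS; rewrite -(partnerE cP cst).
  by move: dab; rewrite !inE => /orP[] /eqP->; [apply: Sa | apply: Sb].
move=> s t d cst dab; rewrite !inE; congr (~~ _); apply/idP/idP.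
  exact: sub cst dab.
by apply: sub dab; rewrite setUC; apply: cst.
Qed.

Definition kempe_swap c a b K : {set T} -> option C :=
  fun e => if e \subset K then omap (tperm a b) (c e) else c e.

Lemma kempe_swapE c a b K x y :
    kempe_closed c a b K ->
  kempe_swap c a b K [set x; y] =
    if x \in K then omap (tperm a b) (c [set x; y]) else c [set x; y].
Proof.
move=> clK; rewrite /kempe_swap subUset !sub1set.
have [xK | //] := boolP (x \in K); have [// | yK /=] := boolP (y \in K).
case cxy: (c _) => [d|] //=; rewrite tpermD //.
  by apply/eqP=> ad; move: yK; rewrite -(clK _ _ _ cxy) ?xK // -ad !inE eqxx.
by apply/eqP=> bd; move: yK; rewrite -(clK _ _ _ cxy) ?xK // -bd !inE eqxx orbT.
Qed.

Lemma kempe_swap_proper c a b K :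
  proper c -> kempe_closed c a b K -> proper (kempe_swap c a b K).
Proof.
move=> cP clK x y z d; rewrite !kempe_swapE //; case: ifP => _; last exact: cP.
exact: (proper_omap (@perm_inj _ _) cP).
Qed.

Lemma missing_kempe_swap c a b K x d :
    kempe_closed c a b K ->
  missing (kempe_swap c a b K) x d =
    missing c x (if x \in K then tperm a b d else d).
Proof.
move=> clK; apply: eq_forallb => y; rewrite kempe_swapE //.
case: ifP => // _; case: (c _) => [s|] //=.
by rewrite !(inj_eq Some_inj) (can2_eq (tpermK a b) (tpermK a b)).
Qed.

Lemma colored_kempe_swap c a b K : colored (kempe_swap c a b K) = colored c.
Proof.
by apply/setP=> e; rewrite !inE /kempe_swap; case: ifP => // _; case: (c e).
Qed.

(** * Vizing fans *)

(** The color of the edge u y can be moved to the edge u x without conflict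
    at x. *)
Definition fan_step c u x y :=
  if c [set u; y] is Some a then missing c x a else false.

(** The edge from u to the head v of a fan is meant to be uncolored, while the
    edges from u to the vertices of s are colored, as [fan_step] requires. *)
Definition fan c u v s := uniq [:: u, v & s] && path (fan_step c u) v s.

Lemma fan_cat c u v s t :
  fan c u v (s ++ t) -> fan c u v s.
Proof.
rewrite /fan -!cat_cons cat_uniq cat_path => /andP[/andP[-> _] /andP[-> _]] //.
Qed.

(** Taking its color away from the last edge of a fan makes this color free both
    at u and at the preceding fan vertex: one step of the rotation of colors,
    done from the far end of the fan. *)
Lemma fan_recolor_last c u v s w o :
    proper c -> fan c u v (rcons s w) -> o != c [set u; w] ->
  let c' := recolor c [set u; w] o in
  exists a, [/\ fan c' u v s, missing c' u a & missing c' (last v s) a].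
Proof.
move=> cP /andP[]; rewrite -!rcons_cons rcons_uniq.
rewrite in_cons negb_or => /andP[/andP[neq_wu w_s] uniq_s].
rewrite rcons_path => /andP[fan_s].
rewrite {1}/fan_step; case cuw: (c _) => [a|] // sa o_a c'.
have c'E x y : x \in v :: s -> c' [set x; y] = c [set x; y].
  move=> xs; rewrite /c' /recolor; case: eqP => // eq_xy.
  have: x \in [set u; w] by rewrite -eq_xy set21.
  rewrite !inE => /orP[] /eqP xE; first by move: uniq_s; rewrite cons_uniq -xE xs.
  by rewrite -xE xs in w_s.
have missE x d : x \in v :: s -> missing c' x d = missing c x d.
  by move=> xs; apply: eq_forallb => y; rewrite c'E.
exists a; split.
- rewrite /fan uniq_s.
  apply: (sub_in_path (P := [in v :: s])) fan_s; last exact/allP.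
  move=> x y xs ys.
  by rewrite /fan_step setUC c'E // setUC; case: (c _) => // d; rewrite missE.
- apply/missingP=> y; rewrite /c' /recolor.
  case: eqP => [_ oa | neq_uy cuy]; first by rewrite oa eqxx in o_a.
  by case: neq_uy; rewrite (cP _ _ _ _ cuw cuy).
- by rewrite missE // mem_last.
Qed.

(** Rotation of a fan: the last edge takes the color a, its former color becomes
    free at u and at the preceding vertex, and so on down to uv. *)
Lemma fan_complete c u v s a :
    proper c -> fan c u v s -> missing c u a -> missing c (last v s) a ->
  exists2 c', proper c' & colored c' = [set u; v] |: colored c.
Proof.
elim/last_ind: s c a => [|s w IHs] c a cP fan_s ua.
  move=> va; exists (recolor c [set u; v] (Some a)); first exact: recolor_proper.
  exact: colored_recolor.
rewrite last_rcons => wa.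
have [|b [fan_s' ub sb]] := fan_recolor_last (o := Some a) cP fan_s.
  by rewrite eq_sym; apply/eqP; move/missingP: ua; apply.
have [|c' c'P c'E] := IHs _ b _ fan_s' ub sb; first exact: recolor_proper.
exists c' => //; rewrite c'E colored_recolor setUCA (setUidPr _) // sub1set.
apply/setUP; right; rewrite inE.
have /andP[_] := fan_s; rewrite rcons_path {2}/fan_step.
by case: (c [set u; w]); rewrite ?andbF.
Qed.

(** A swap away from u does not disturb a fan whose edges carry neither swapped
    color: a does not occur at u, and b occurs at u on the edge u w only. *)
Lemma fan_kempe_swap c a b K u w v s :
    proper c -> kempe_closed c a b K -> missing c u a -> u \notin K ->
    c [set u; w] = Some b -> w \notin s ->
  path (fan_step c u) v s -> path (fan_step (kempe_swap c a b K) u) v s.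
Proof.
move=> cP clK ua uK cuw; elim: s v => //= y s IHs v.
rewrite in_cons negb_or => /andP[neq_wy ws] /andP[vy /IHs-> //].
rewrite andbT; move: vy; rewrite /fan_step kempe_swapE // (negbTE uK).
case cuy: (c _) => [d|] // vd; rewrite missing_kempe_swap //.
case: ifP => // _; rewrite tpermD //.
  by apply/eqP => ad; move/missingP/(_ y): ua; rewrite cuy ad.
by apply: contraNneq neq_wy => bd; apply/eqP/(cP _ _ _ _ cuw); rewrite cuy bd.
Qed.

(** The fan cannot be extended, since the color b free at its last vertex is
    already used inside it, on u w.  The predecessor of w and the last vertex
    both miss b, and one of the two has an (a, b)-chain that avoids u.  Swapping
    chains away from u frees a at that vertex, and the fan can be rotated up to
    there.  If the predecessor of w is swapped, only the part of the fan
    before w is used; otherwise the step to w survives, as b is still missing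
    at that predecessor. *)
Lemma fan_loop_complete c u v s w a b :
    proper c -> fan c u v s -> missing c u a -> missing c (last v s) b ->
    c [set u; w] = Some b -> w \in s ->
  exists2 c', proper c' & colored c' = [set u; v] |: colored c.
Proof.
move=> cP fan_s ua sb cuw /splitPr ws; case: ws fan_s sb => s1 s2 fan_s.
rewrite last_cat /= => s2b; have fan_s1 := fan_cat fan_s.
have /andP[uniq_s] := fan_s; rewrite cat_path /= => /and3P[path1 s1w path2].
have s1b : missing c (last v s1) b by move: s1w; rewrite /fan_step cuw.
have [ws1 ws2 neq_s12] : [/\ w \notin s1, w \notin s2 & last v s1 != last w s2].
  move: uniq_s; rewrite cons_uniq -cat_cons cat_uniq.
  case/and4P=> _ _ /hasPn disj /andP[ws2 _]; split=> //.
    by have := disj w (mem_head _ _); rewrite in_cons negb_or => /andP[].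
  by apply: contraNneq (disj _ (mem_last w s2)) => <-; apply: mem_last.
have [K [clK uK sK]] := kempe_separate cP ua s1b s2b neq_s12.
pose c1 := kempe_swap c a b K; have c1P : proper c1 by apply: kempe_swap_proper.
rewrite -(colored_kempe_swap c a b K) -/c1.
have u1a : missing c1 u a by rewrite missing_kempe_swap // (negbTE uK).
have path1' : path (fan_step c1 u) v s1 by apply: fan_kempe_swap cuw ws1 path1.
have [s1K | s1K] := boolP (last v s1 \in K).
  apply: (fan_complete (s := s1) c1P _ u1a).
    by have /andP[uniq_s1 _] := fan_s1; rewrite /fan uniq_s1.
  by rewrite missing_kempe_swap // s1K tpermL.
rewrite (negbTE s1K) /= in sK.
apply: (fan_complete (s := s1 ++ w :: s2) c1P _ u1a).
  rewrite /fan uniq_s cat_path path1' /=; apply/andP; split.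
    rewrite /fan_step /c1 kempe_swapE // (negbTE uK) cuw.
    by rewrite missing_kempe_swap // (negbTE s1K).
  exact: fan_kempe_swap cuw ws2 path2.
by rewrite last_cat missing_kempe_swap //= sK tpermL.
Qed.

(** A fan at u is grown as long as possible.  It can end in three ways: at a
    vertex without missing color, which gives the second outcome by rotating
    the rest of the fan after uncoloring the last edge; at a vertex sharing a
    missing color with u; or by a loop. *)
Lemma fan_dichotomy c u v a b :
    proper c -> u != v -> c [set u; u] = None -> c [set u; v] = None ->
    missing c u a -> missing c v b ->
  (exists2 c', proper c' & colored c' = [set u; v] |: colored c) \/
  exists w c', [/\ [set u; w] \in colored c, forall d, ~~ missing c w d,
    proper c' & colored c' = [set u; v] |: (colored c :\ [set u; w])].
Proof.
move=> cP neq_uv cuu cuv ua vb.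
set outcome := _ \/ _; have [n] := ubnP #|T|.
suff grow s : fan c u v s -> #|T| < n + size s -> outcome.
  move=> lt_n; apply: (grow [::]); last by rewrite addn0.
  by rewrite /fan /= !inE neq_uv.
elim: n s => [|n IHn] s fan_s lt_n.
  (* The fan would have more vertices than T. *)
  have /andP[/card_uniqP card_s _] := fan_s.
  move: (max_card [in [:: u, v & s]]); rewrite card_s.
  by move=> /ltnW/ltnW; rewrite leqNgt lt_n.
have [/existsP[d sd] | full] := boolP [exists d, missing c (last v s) d]; last first.
  right; case: (lastP s) fan_s full {lt_n} => [|{}s w] fan_s.
    by case/existsP; exists b.
  rewrite last_rcons => /existsPn full.
  have cuw: [set u; w] \in colored c.
    have /andP[_] := fan_s; rewrite rcons_path inE /fan_step.
    by case: (c _); rewrite ?andbF.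
  have [|d [fan_s' ud sd]] := fan_recolor_last (o := None) cP fan_s.
    by move: cuw; rewrite inE; case: (c _).
  have [|c' c'P c'E] := fan_complete _ fan_s' ud sd; first exact: uncolor_proper.
  by exists w, c'; rewrite c'E colored_uncolor.
have [ud | /notmissingP[w cuw]] := boolP (missing c u d).
  by left; apply: fan_complete fan_s ud sd.
have [ws | ws] := boolP (w \in s).
  by left; apply: fan_loop_complete fan_s ua sd cuw ws.
apply: (IHn (rcons s w)); last by rewrite size_rcons addnS.
have /andP[uniq_s path_s] := fan_s.
rewrite /fan -!rcons_cons rcons_uniq uniq_s rcons_path path_s !inE (negbTE ws).
rewrite /fan_step cuw sd !andbT orbF; apply/norP; split.
  by apply/eqP=> wu; rewrite wu cuu in cuw.
by apply/eqP=> wv; rewrite wv cuv in cuw.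
Qed.

(** * Degrees *)

Lemma saturated_degree c (E : {set {set T}}) w :
    colored c \subset E -> (forall a, ~~ missing c w a) -> #|C| <= degree E w.
Proof.
move=> sub_cE full.
have /fin_all_exists[h hE] : forall a, exists y, c [set w; y] = Some a.
  by move=> a; apply/notmissingP.
have inj_h : injective (fun a => [set w; h a]).
  by move=> a b eq_ab; apply: Some_inj; rewrite -!hE eq_ab.
rewrite -(card_imset _ inj_h); apply/subset_leq_card/subsetP=> _ /imsetP[a _ ->].
by rewrite inE set21 andbT (subsetP sub_cE) // inE hE.
Qed.

End PartialColoring.

(** * The chromatic index *)

Lemma simple_edge (T : finType) (E : {set {set T}}) e x :
  simple_graph E -> e \in E -> x \in e -> exists2 y, x != y & e = [set x; y].
Proof.
move=> /forall_inP sE /sE/cards2P[y [z [neq_yz ->]]].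
rewrite !inE => /orP[] /eqP->; first by exists z.
by exists y; rewrite 1?eq_sym // setUC.
Qed.

Lemma simple_graphS (T : finType) (E E' : {set {set T}}) :
  E' \subset E -> simple_graph E -> simple_graph E'.
Proof. by move=> /subsetP sE /forall_inP H; apply/forall_inP=> e /sE/H. Qed.

(** Trades colorings defined on the subtype of edges for partial colorings of
    all sets, which can be modified one edge at a time. *)
Lemma edge_colorableP (T : finType) (E : {set {set T}}) k :
    simple_graph E ->
  reflect (exists2 c : {set T} -> option 'I_k, proper c & colored c = E)
          (edge_colorable E k).
Proof.
move=> sE; apply: (iffP existsP) => [[c /forallP cP] | [c cP cE]].
  exists (fun e => omap c (insub e)) => [x y z a|]; last first.
    by apply/setP=> e; rewrite inE; case: insubP => [f -> // | /negbTE->].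
  case: insubP => //= e1 _ e1E [c1]; case: insubP => //= e2 _ e2E [c2].
  apply: (@set2_injr _ x); rewrite -e1E -e2E; congr val; apply/eqP.
  have /forallP/(_ e2) := cP e1; rewrite c1 c2 eqxx implybF negb_and !negbK.
  case/orP=> // /pred0P/(_ x) /=.
  by rewrite e1E e2E !inE eqxx.
have /fin_all_exists[h hE] :
    forall e : {e | e \in E}, exists a, c (val e) = Some a.
  move=> [e eE] /=; move: eE; rewrite -{1}cE inE.
  by case: (c e) => // a _; exists a.
exists (finfun h); apply/forallP=> e1; apply/forallP=> e2.
apply/implyP=> /andP[neq_e /pred0Pn[x /andP[/= xe1 xe2]]].
apply: contraNneq neq_e; rewrite !ffunE => eq_h; apply/eqP/val_inj.
have [y _ e1E] := simple_edge sE (valP e1) xe1.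
have [z _ e2E] := simple_edge sE (valP e2) xe2.
rewrite e1E e2E (cP x y z (h e1)) // -?e1E ?hE //.
by rewrite -e2E hE eq_h.
Qed.

Section ChromaticIndex.

Variables (T : finType) (E : {set {set T}}).
Hypothesis simpleE : simple_graph E.

Lemma edge_colorable_leq k l :
  edge_colorable E k -> k <= l -> edge_colorable E l.
Proof.
move=> /(edge_colorableP _ simpleE)[c cP cE] le_kl; apply/edge_colorableP=> //.
exists (fun e => omap (widen_ord le_kl) (c e)).
  by apply: proper_omap cP => i j /(congr1 val)/= ?; apply: val_inj.
by apply/setP=> e; rewrite -cE !inE; case: (c e).
Qed.

Lemma chromatic_index_le k : (chromatic_index E <= k) = edge_colorable E k.
Proof.
rewrite /chromatic_index; case: ex_minnP => m colm min_m.
by apply/idP/idP => [|/min_m //]; apply: edge_colorable_leq.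
Qed.

Lemma max_degree_le_chromatic_index : max_degree E <= chromatic_index E.
Proof.
have : edge_colorable E (chromatic_index E) by rewrite -chromatic_index_le.
case/(edge_colorableP _ simpleE)=> c cP cE; apply/bigmax_leqP=> v _.
rewrite /degree -(card_in_imset (f := c)) => [|e f]; last first.
  rewrite !inE => /andP[eE ve] /andP[fE vf].
  have := eE; rewrite -{1}cE inE; case ce: (c e) => [a|] // _ cf.
  have [y _ eE'] := simple_edge simpleE eE ve.
  have [z _ fE'] := simple_edge simpleE fE vf.
  by rewrite eE' fE' (cP v y z a) -?eE' -?fE' // -cf.
apply: leq_trans (_ : #|[set Some a | a : 'I_(chromatic_index E)]| <= _).
  apply/subset_leq_card/subsetP=> _ /imsetP[e + ->]; rewrite inE -{1}cE inE.
  by case: (c e) => // a _; apply: imset_f.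
by rewrite card_imset ?card_ord //; apply: Some_inj.
Qed.

End ChromaticIndex.

Lemma chromatic_index_setU1 (T : finType) (E : {set {set T}}) e :
  simple_graph (e |: E) -> chromatic_index (e |: E) <= (chromatic_index E).+1.
Proof.
move=> sEe; have sE := simple_graphS (subsetU1 e E) sEe.
have : edge_colorable E (chromatic_index E) by rewrite -chromatic_index_le.
rewrite chromatic_index_le //; move: (chromatic_index E) => k.
case/(edge_colorableP _ sE)=> c cP cE.
have unused f : omap (lift ord_max) (c f) <> Some ord_max.
  by case: (c f) => //= b /Some_inj/eqP; rewrite eq_sym (negbTE (neq_lift _ _)).
apply/edge_colorableP=> //.
exists (fun f => if f == e then Some ord_max else omap (lift ord_max) (c f)).
  move=> x y z a; case: eqP => [xye | _]; case: eqP => [xze | _].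
  - by move=> _ _; apply: (@set2_injr _ x); rewrite xye.
  - by move=> <- /unused.
  - by move=> + eq_a; rewrite -eq_a => /unused.
  - exact: (proper_omap (h := lift (@ord_max k)) lift_inj cP).
by apply/setP=> f; rewrite !inE -cE inE; case: eqP => // _; case: (c f).
Qed.

(** * Mitigating sets *)

Lemma edgeless_chromatic_index (T : finType) :
  chromatic_index (set0 : {set {set T}}) = 0.
Proof.
have s0 : simple_graph (set0 : {set {set T}}) by apply/forall_inP=> e; rewrite inE.
apply/eqP; rewrite -leqn0 chromatic_index_le //; apply/edge_colorableP => //.
by exists (fun=> None) => //; apply/setP=> e; rewrite !inE.
Qed.

Lemma mitigating_allE (T : finType) (E : {set {set T}}) :
  E != set0 -> mitigating E E.
Proof.
case/set0Pn=> e eE; rewrite /mitigating subxx setDv edgeless_chromatic_index lt0n.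
apply/negP=> /eqP; rewrite /chromatic_index; case: ex_minnP => k + _ k0.
by rewrite k0 => /existsP[c _]; case: (c (Sub e eE)).
Qed.

(** Putting one edge e of F back restores the chromatic index, by minimality,
    and a single edge raises it by at most one.  So the minimum over the sets
    that lower the chromatic index by exactly one is the minimum size of a
    mitigating set. *)
Lemma min_mitigating_drop1 (T : finType) (E F : {set {set T}}) :
    simple_graph E -> mitigating E F ->
    (forall F', mitigating E F' -> #|F| <= #|F'|) ->
  (chromatic_index (E :\: F)).+1 = chromatic_index E.
Proof.
move=> sE /andP[sFE ltF] minF; apply/eqP; rewrite eqn_leq ltF /=.
have /set0Pn[e eF] : F != set0 by apply: contraTneq ltF => ->; rewrite setD0 ltnn.
have : ~~ mitigating E (F :\ e).
  by apply/negP=> /minF; rewrite [#|F|](cardsD1 e) eF ltnn.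
rewrite /mitigating (subset_trans (subD1set F e) sFE) /= -leqNgt => /leq_trans-> //.
have -> : E :\: (F :\ e) = e |: (E :\: F).
  apply/setP=> f; rewrite !inE; case: eqP => // ->.
  by rewrite (subsetP sFE).
apply/chromatic_index_setU1/(simple_graphS _ sE).
by rewrite subUset sub1set (subsetP sFE) // subsetDl.
Qed.

Lemma chromatic_edge_stabilityE (T : finType) (E F : {set {set T}}) :
    simple_graph E -> mitigating E F ->
    (forall F', mitigating E F' -> #|F| <= #|F'|) ->
  chromatic_edge_stability E = #|F|.
Proof.
move=> sE mitF minF; apply/eqP; rewrite eqn_leq; apply/andP; split.
  have : (F \subset E) && ((chromatic_index (E :\: F)).+1 == chromatic_index E).
    by rewrite (min_mitigating_drop1 sE mitF minF) eqxx andbT; case/andP: mitF.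
  rewrite /chromatic_edge_stability; have := mem_index_enum F.
  elim: (index_enum _) => // F' s IHs; rewrite in_cons big_cons.
  case/predU1P => [<- -> | /IHs{}IHs /IHs]; first exact: geq_minl.
  by case: ifP => // _; apply: leq_trans (geq_minr _ _).
rewrite /chromatic_edge_stability; elim/big_ind: _ => [|m n|F' /andP[sF' /eqP eF']].
- by apply: subset_leq_card; case/andP: mitF.
- by rewrite leq_min => -> ->.
- by apply: minF; rewrite /mitigating sF' -eF' leqnn.
Qed.

(** The uncolored edge uv is either colored or traded for an edge to a vertex
    that sees all chi'(E) - 1 colors. *)
Lemma mitigating_exchange (T : finType) (E F : {set {set T}}) u v :
    simple_graph E -> mitigating E F -> [set u; v] \in F ->
    maxn (degree E u) (degree E v) < max_degree E - 1 ->
  mitigating E (F :\ [set u; v]) \/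
  exists2 w, [set u; w] \in E :\: F & max_degree E - 1 <= degree E w /\
    mitigating E ([set u; w] |: F :\ [set u; v]).
Proof.
set k := (chromatic_index E).-1.
move=> sE /andP[sFE ltF] uvF; rewrite gtn_max => /andP[low_u low_v].
have le_k : max_degree E - 1 <= k.
  by rewrite /k -subn1 leq_sub2r // max_degree_le_chromatic_index.
have kE : k.+1 = chromatic_index E by rewrite /k prednK // (leq_ltn_trans _ ltF).
have sEF : simple_graph (E :\: F) by apply: simple_graphS sE; apply: subsetDl.
have : chromatic_index (E :\: F) <= k by rewrite -ltnS kE.
rewrite chromatic_index_le // => /(edge_colorableP _ sEF)[c cP cE].
have uncolored e : e \notin E :\: F -> c e = None.
  by rewrite -cE inE; case: (c e).
have uvE : [set u; v] \in E by apply: (subsetP sFE).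
have mitI (F' : {set {set T}}) (c' : {set T} -> option 'I_k) :
    F' \subset E -> proper c' -> colored c' = E :\: F' -> mitigating E F'.
  move=> sF'E c'P c'E; rewrite /mitigating sF'E /= -kE ltnS chromatic_index_le.
    by apply/edge_colorableP; [apply: simple_graphS sE; apply: subsetDl | exists c'].
  by apply: simple_graphS sE; apply: subsetDl.
have sat w : (forall a, ~~ missing c w a) -> max_degree E - 1 <= degree E w.
  move=> full; apply: leq_trans le_k _; rewrite -[k in k <= _]card_ord.
  by apply: saturated_degree full; rewrite cE subsetDl.
have low x : degree E x < max_degree E - 1 -> exists a, missing c x a.
  rewrite ltnNge => lowx; apply/existsP; apply: contraR lowx => /existsPn.
  exact: sat.
have [[a ua] [b vb]] := (low u low_u, low v low_v).
have neq_uv : u != v.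
  have [|y neq_uy] := @simple_edge _ E _ u sE uvE; first exact: set21.
  by move/set2_injr->.
have cuu : c [set u; u] = None.
  apply: uncolored; apply: contraL sEF => uuE; apply/forall_inPn.
  by exists [set u; u]; rewrite // setUid cards1.
have cuv : c [set u; v] = None by apply: uncolored; rewrite inE uvF.
have [[c' c'P c'E] | [w [c' [uwc satw c'P c'E]]]] :=
  fan_dichotomy cP neq_uv cuu cuv ua vb.
  left; apply: mitI c'P _; first exact: subset_trans (subD1set _ _) sFE.
  rewrite c'E cE; apply/setP=> e; rewrite !inE; case: eqP => // ->.
  by rewrite uvE.
rewrite cE in uwc; have [uwE uwF] := setDP uwc.
right; exists w => //; split; first exact: sat.
apply: mitI c'P _.
  by rewrite subUset sub1set uwE (subset_trans (subD1set _ _) sFE).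
rewrite c'E cE; apply/setP=> e; rewrite !inE.
case: eqP => [-> | _] /=; last by case: eqP.
by rewrite uvE orbF andbT; apply/esym; apply: contraNneq uwF => <-.
Qed.

Theorem theorem7 (T : finType) (E : {set {set T}})
  (simpleE : simple_graph E) (nonemptyE : E != set0) :
  exists S : {set {set T}},
    [/\ mitigating E S,
        #|S| = chromatic_edge_stability E &
        forall u v : T, [set u; v] \in S ->
          max_degree E - 1 <= maxn (degree E u) (degree E v)].
Proof.
pose high x := max_degree E - 1 <= degree E x.
pose low_edges (F : {set {set T}}) := [set e in F | [forall x in e, ~~ high x]].
have [F0 mitF0 minF0] :=
  arg_minnP (fun F : {set {set T}} => #|F|) (mitigating_allE nonemptyE).
have [|F /andP[mitF /eqP cardF] minF] := @arg_minnP _ F0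
  (fun F => mitigating E F && (#|F| == #|F0|)) (fun F => #|low_edges F|).
  by rewrite mitF0 eqxx.
exists F; split=> // [|u v uvF].
  by rewrite cardF (chromatic_edge_stabilityE simpleE mitF0).
rewrite leqNgt; apply/negP=> low_uv.
have [mitF' | [w /setDP[uwE uwF] [high_w mitF']]] :=
  mitigating_exchange simpleE mitF uvF low_uv.
  by have := minF0 _ mitF'; rewrite -cardF [#|F|](cardsD1 [set u; v]) uvF ltnn.
set F' := _ |: _ in mitF'; have cardF' : #|F'| = #|F0|.
  by rewrite cardsU1 !inE (negbTE uwF) andbF -cardF (cardsD1 [set u; v] F) uvF.
have := minF F'; rewrite mitF' cardF' eqxx => /(_ isT).
apply/negP; rewrite -ltnNge; apply: proper_card; apply/properP; split.
  apply/subsetP=> e; rewrite !inE => /andP[/predU1P[-> | /andP[_ ->]] //].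
  by move/forall_inP/(_ w (set22 _ _)); rewrite /high high_w.
have low_uvE : [set u; v] \in low_edges F.
  rewrite inE uvF; apply/forall_inP=> x.
  move: low_uv; rewrite gtn_max /high -!ltnNge => /andP[lu lv].
  by rewrite !inE => /orP[] /eqP->.
exists [set u; v] => //; rewrite !inE eqxx /= orbF.
by apply/nandP; left; apply: contraNneq uwF => <-.
Qed.
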